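(* Suppose $\mathcal{Y}=\mathbb{R}^n$, and each $f_i$ is strongly convex with constant $\mu_i>0$ and differentiable with $\nabla f_i$ Lipschitz continuous on $\mathbb{R}^n$ with constant $L_i>0$, $i=1,\dots,m$. Let $\mu=\min_i\mu_i$, $L=\max_iL_i$, $L_h=(1/\mu)(2+2\cos(\pi/m))$, $\mu_h=(1/L)(2-2\cos(\pi/m))$, $h=-g$, and let $\boldsymbol{\lambda}^\star$ be a dual optimal solution, i.e. a maximizer of $g$. Let $\{\boldsymbol{\lambda}^{(k)}\}_{k\ge0}$ be generated by the inexact dual algorithm with distortions satisfying $\|\mathbf{r}_i^{(k)}\|\le\varepsilon_i$ for all $i,k$ and with stepsizes satisfying $0<\gamma_k\le1/L_h$ for all $k\ge0$ and $\sum_{k=0}^\infty\gamma_k=\infty$. Then: 1. $\displaystyle\limsup_k\ \big(h(\boldsymbol{\lambda}^{(k)})-h(\boldsymbol{\lambda}^\star)\big)\le\frac{\epsilon^2}{2\mu_h}$. 2. If $\gamma_k=(c/\mu_h)/(k+1)^p$ with $0<p\le1$ and $0<c\le\mu_h/L_h$, then there is a constant $C$ (independent of $k$) such that for all sufficiently large $k$, $$h(\boldsymbol{\lambda}^{(k)})-h(\boldsymbol{\lambda}^\star)\le\frac{C}{k^{c/p}}+\frac{\epsilon^2}{2\mu_h}.$$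
   Context: Let $m\ge2$, $n\ge1$ be integers, $\mathcal{Y}\subseteq\mathbb{R}^n$ a closed convex set, and $f_i:\mathbb{R}^n\to\mathbb{R}$, $i=1,\dots,m$, strictly convex closed functions. For $\mathbf{y}=(\mathbf{y}_1,\dots,\mathbf{y}_m)\in(\mathbb{R}^n)^m=\mathbb{R}^{nm}$ put $f(\mathbf{y})=\sum_{i=1}^m f_i(\mathbf{y}_i)$, let $\bar{\mathcal{Y}}=\mathcal{Y}^m$, and $\mathbf{A}\mathbf{y}=(\mathbf{y}_1-\mathbf{y}_2,\dots,\mathbf{y}_{m-1}-\mathbf{y}_m)\in\mathbb{R}^{n(m-1)}$. The dual function is $g(\boldsymbol{\lambda})=\inf_{\mathbf{y}\in\bar{\mathcal{Y}}}\big[f(\mathbf{y})+\boldsymbol{\lambda}^{T}\mathbf{A}\mathbf{y}\big]$, $\boldsymbol{\lambda}\in\mathbb{R}^{n(m-1)}$. Inexact dual algorithm: start from any $\boldsymbol{\lambda}^{(0)}\in\mathbb{R}^{n(m-1)}$; for $k=0,1,2,\dots$ let $\mathbf{y}^{(k)}=\arg\min_{\mathbf{y}\in\bar{\mathcal{Y}}}\big[f(\mathbf{y})+(\boldsymbol{\lambda}^{(k)})^{T}\mathbf{A}\mathbf{y}\big]$, let $\hat{\mathbf{y}}_i^{(k)}=\mathbf{y}_i^{(k)}+\mathbf{r}_i^{(k)}$ where $\mathbf{r}_i^{(k)}\in\mathbb{R}^n$ are arbitrary distortions, let $\hat{\mathbf{d}}^{(k)}=\mathbf{A}\hat{\mathbf{y}}^{(k)}$,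 and set $\boldsymbol{\lambda}^{(k+1)}=\boldsymbol{\lambda}^{(k)}+\gamma_k\hat{\mathbf{d}}^{(k)}$. The distortions are bounded by constants: $\|\mathbf{r}_i^{(k)}\|\le\varepsilon_i$ for all $i$ and $k$, and $\epsilon:=\sqrt{\sum_{i=1}^{m-1}(\varepsilon_i+\varepsilon_{i+1})^2}$. Norms are Euclidean. A function $\varphi$ is strongly convex with constant $\sigma>0$ if $\varphi-\frac{\sigma}{2}\|\cdot\|^2$ is convex. *)

(* Defs.v *)
From HB Require Import structures.
From mathcomp Require Import all_boot all_order all_algebra.
From mathcomp Require Import all_classical all_reals all_analysis.

Set Implicit Arguments.
Unset Strict Implicit.
Unset Printing Implicit Defensive.

Import Order.TTheory GRing.Theory Num.Theory.
Import numFieldNormedType.Exports.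

Local Open Scope classical_set_scope.
Local Open Scope ring_scope.

(* A point (y_1, ..., y_m) of (R^n)^m is the m x n matrix whose i-th row is   *)
(* y_i; likewise for dual vectors, which have m - 1 blocks. The library's     *)
(* `|_| on matrices is the sup norm, so the Euclidean one is defined here.    *)

Definition dotp (R : realType) (m n : nat) (u v : 'M[R]_(m, n)) : R :=
  \sum_(i < m) \sum_(j < n) u i j * v i j.

Definition enorm (R : realType) (m n : nat) (u : 'M[R]_(m, n)) : R :=
  Num.sqrt (dotp u u).

Definition strictly_convex (R : realType) (n : nat) (phi : 'rV[R]_n -> R) :=
  forall (x y : 'rV[R]_n) (t : R), x != y -> 0 < t -> t < 1 ->
    phi (t *: x + (1 - t) *: y) < t * phi x + (1 - t) * phi y.

Definition closed_function (R : realType) (n : nat) (phi : 'rV[R]_n -> R) :=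
  closed [set p : 'rV[R]_n * R | phi p.1 <= p.2].

Definition strongly_convex (R : realType) (n : nat) (sigma : R)
    (phi : 'rV[R]_n -> R) :=
  convex_function [set: 'rV[R]_n]
    (fun x : 'rV[R]_n => phi x - sigma / 2 * enorm x ^+ 2).

Definition gradient (R : realType) (n : nat) (phi : 'rV[R]_n -> R)
    (x : 'rV[R]_n) : 'rV[R]_n :=
  \row_(j < n) 'D_(delta_mx 0 j) phi x.

Definition lipschitz_gradient (R : realType) (n : nat) (L : R)
    (phi : 'rV[R]_n -> R) :=
  forall x y : 'rV[R]_n,
    enorm (gradient phi x - gradient phi y) <= L * enorm (x - y).

Lemma ord_here_subproof (m : nat) (i : 'I_m.-1) : (i < m)%N.
Proof. exact: leq_trans (ltn_ord i) (leq_pred m). Qed.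

Lemma ord_next_subproof (m : nat) (i : 'I_m.-1) : (i.+1 < m)%N.
Proof. by rewrite -ltn_predRL. Qed.

(* For an index i of a consecutive pair, the indices i and i + 1 in 'I_m.     *)
Definition ord_here (m : nat) (i : 'I_m.-1) : 'I_m :=
  Ordinal (ord_here_subproof i).

Definition ord_next (m : nat) (i : 'I_m.-1) : 'I_m :=
  Ordinal (ord_next_subproof i).

Definition diff_op (R : realType) (m n : nat) (y : 'M[R]_(m, n)) :
    'M[R]_(m.-1, n) :=
  \matrix_(i < m.-1) (row (ord_here i) y - row (ord_next i) y).

Definition power_set (R : realType) (m n : nat) (Y : set 'rV[R]_n) :
    set 'M[R]_(m, n) :=
  [set y | forall i : 'I_m, Y (row i y)].

Definition lagrangian (R : realType) (m n : nat)
    (f : 'I_m -> 'rV[R]_n -> R) (lambda : 'M[R]_(m.-1, n))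
    (y : 'M[R]_(m, n)) : R :=
  \sum_(i < m) f i (row i y) + dotp lambda (diff_op y).

(* Extended-real valued, as the infimum may be -oo for a general family f.    *)
Definition dual_function (R : realType) (m n : nat) (Y : set 'rV[R]_n)
    (f : 'I_m -> 'rV[R]_n -> R) (lambda : 'M[R]_(m.-1, n)) : \bar R :=
  ereal_inf [set (lagrangian f lambda y)%:E | y in power_set Y].

Definition is_argmin (R : realType) (T : Type) (D : set T) (F : T -> R)
    (x : T) : Prop :=
  D x /\ forall z, D z -> F x <= F z.

Definition inexact_dual_algorithm (R : realType) (m n : nat)
    (Y : set 'rV[R]_n) (f : 'I_m -> 'rV[R]_n -> R) (gamma : nat -> R)
    (r y : nat -> 'M[R]_(m, n)) (lambda : nat -> 'M[R]_(m.-1, n)) : Prop :=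
  forall k : nat,
    is_argmin (power_set Y) (lagrangian f (lambda k)) (y k) /\
    lambda k.+1 = lambda k + gamma k *: diff_op (y k + r k).

Definition dual_optimal (R : realType) (m n : nat) (Y : set 'rV[R]_n)
    (f : 'I_m -> 'rV[R]_n -> R) (lambda : 'M[R]_(m.-1, n)) : Prop :=
  forall l : 'M[R]_(m.-1, n),
    (dual_function Y f l <= dual_function Y f lambda)%E.

(* The proof of 0 < m only provides the default value of the iterated min.    *)
Definition min_over (R : realType) (m : nat) (m_gt0 : (0 < m)%N)
    (a : 'I_m -> R) : R :=
  \big[Num.min/a (Ordinal m_gt0)]_(i < m) a i.

Definition max_over (R : realType) (m : nat) (m_gt0 : (0 < m)%N)
    (a : 'I_m -> R) : R :=
  \big[Num.max/a (Ordinal m_gt0)]_(i < m) a i.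

Definition total_error (R : realType) (m : nat) (eps : 'I_m -> R) : R :=
  Num.sqrt (\sum_(i < m.-1) (eps (ord_here i) + eps (ord_next i)) ^+ 2).

(* Main.v *)
(** Write [h = - g], and let [y] minimize the Lagrangian at [lambda].  Strong
    convexity of the [f i] makes the Lagrangian grow at least quadratically
    around [y] and the Lipschitz gradients make it grow at most quadratically.
    As [A A^T] has its spectrum in [[2 - 2 cos (pi/m), 2 + 2 cos (pi/m)]], this
    yields [h (lambda + d) <= h lambda - <d, A y> + L_h / 2 |d|^2] and
    [h lambda - h lambda_star <= |A y|^2 / (2 mu_h)].  For a step
    [d = gamma (A y + A r)] with [gamma <= 1 / L_h] these combine into
    [b_{k+1} <= (1 - gamma_k mu_h) b_k] for the excess
    [b_k = h lambda_k - h lambda_star - eps^2 / (2 mu_h)], so that [b_k] is at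
    most a constant times [exp (- mu_h * sum_{j < k} gamma_j)]. *)
Require Import Defs.
From HB Require Import structures.
From mathcomp Require Import all_boot all_order all_algebra.
From mathcomp Require Import all_classical all_reals all_analysis.
From mathcomp Require Import ring lra.

Set Implicit Arguments.
Unset Strict Implicit.
Unset Printing Implicit Defensive.

Import Order.TTheory GRing.Theory Num.Theory.
Import numFieldNormedType.Exports.

Local Open Scope classical_set_scope.
Local Open Scope ring_scope.

(** * Inner product and Euclidean norm on matrices *)

Section InnerProduct.
Context {R : realType} {m n : nat}.
Implicit Types (u v w : 'M[R]_(m, n)) (a : R).

Lemma dotpC u v : dotp u v = dotp v u.
Proof.
by apply: eq_bigr => i _; apply: eq_bigr => j _; rewrite mulrC.
Qed.

Lemma dotpDr u v w : dotp u (v + w) = dotp u v + dotp u w.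
Proof.
rewrite /dotp -big_split; apply: eq_bigr => i _ /=.
by rewrite -big_split; apply: eq_bigr => j _ /=; rewrite mxE mulrDr.
Qed.

Lemma dotpZr a u v : dotp u (a *: v) = a * dotp u v.
Proof.
rewrite /dotp mulr_sumr; apply: eq_bigr => i _.
by rewrite mulr_sumr; apply: eq_bigr => j _; rewrite mxE mulrCA.
Qed.

Lemma dotpDl u v w : dotp (u + v) w = dotp u w + dotp v w.
Proof. by rewrite dotpC dotpDr !(dotpC w). Qed.

Lemma dotpZl a u v : dotp (a *: u) v = a * dotp u v.
Proof. by rewrite dotpC dotpZr dotpC. Qed.

Lemma dotpNr u v : dotp u (- v) = - dotp u v.
Proof. by rewrite -scaleN1r dotpZr mulN1r. Qed.

Lemma dotpNl u v : dotp (- u) v = - dotp u v.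
Proof. by rewrite dotpC dotpNr dotpC. Qed.

Definition dotpE := (dotpDl, dotpDr, dotpNl, dotpNr, dotpZl, dotpZr).

Lemma dotp_ge0 u : 0 <= dotp u u.
Proof.
by apply: sumr_ge0 => i _; apply: sumr_ge0 => j _; rewrite -expr2 sqr_ge0.
Qed.

Lemma dotp_eq0 u : dotp u u = 0 -> u = 0.
Proof.
move/eqP; rewrite psumr_eq0 => [/allP u0|i _]; last first.
  by apply: sumr_ge0 => j _; rewrite -expr2 sqr_ge0.
apply/matrixP => i j; rewrite mxE.
have := u0 i (mem_index_enum i).
rewrite /= psumr_eq0 => [/allP /(_ j (mem_index_enum j))|k _].
  by rewrite /= -expr2 sqrf_eq0 => /eqP.
by rewrite -expr2 sqr_ge0.
Qed.

Lemma sqr_enorm u : enorm u ^+ 2 = dotp u u.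
Proof. by rewrite sqr_sqrtr // dotp_ge0. Qed.

Lemma enorm_ge0 u : 0 <= enorm u.
Proof. exact: sqrtr_ge0. Qed.

(** Cauchy-Schwarz, from expanding [|b u - a v|^2 >= 0] with [a = |u|] and [b = |v|] and dividing by
    [a * b]. When [a * b] vanishes, one of the two vectors is zero. *)
Lemma dotp_le_enorm u v : dotp u v <= enorm u * enorm v.
Proof.
set a := enorm u; set b := enorm v.
have a0 : 0 <= a := enorm_ge0 u.
have b0 : 0 <= b := enorm_ge0 v.
have := dotp_ge0 (b *: u - a *: v).
rewrite !dotpE (dotpC v u) -!sqr_enorm -/a -/b => H.
have [ab0|] := ltP 0 (a * b).
  by rewrite -(ler_pM2l ab0); nra.
rewrite le_eqVlt ltNge mulr_ge0 // orbF mulf_eq0 => /orP[] /eqP z.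
  by rewrite (@dotp_eq0 u) ?z ?mul0r -?sqr_enorm -/a ?z ?expr0n //
    -(scale0r u) dotpZl mul0r.
by rewrite (@dotp_eq0 v) ?z ?mulr0 -?sqr_enorm -/b ?z ?expr0n //
    -(scale0r v) dotpZr mul0r.
Qed.

Lemma dotpB_le u v a b : enorm u <= a -> enorm v <= b ->
  dotp (u - v) (u - v) <= (a + b) ^+ 2.
Proof.
move=> ua vb; have := enorm_ge0 u; have := enorm_ge0 v.
have := dotp_le_enorm (- u) v.
have -> : enorm (- u) = enorm u by rewrite /enorm !dotpE opprK.
by rewrite !dotpE (dotpC v u) -!sqr_enorm; nra.
Qed.

End InnerProduct.

Lemma dotp_rowE (R : realType) (n : nat) (u v : 'rV[R]_n) :
  dotp u v = \sum_(j < n) u 0 j * v 0 j.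
Proof. by rewrite /dotp big_ord1. Qed.

Lemma dotp_rows (R : realType) (m n : nat) (u v : 'M[R]_(m, n)) :
  dotp u v = \sum_(i < m) dotp (row i u) (row i v).
Proof.
apply: eq_bigr => i _; rewrite dotp_rowE.
by apply: eq_bigr => j _; rewrite !mxE.
Qed.

(** * The difference operator and its adjoint *)

Section BackwardDifference.
Context {R : realType}.
Implicit Types a b : nat -> R.

(** The convention [a (-1) = 0] makes this the adjoint of the forward difference in summation by
    parts, with no boundary term at the left end. *)
Definition backward_diff a (i : nat) : R :=
  a i - (if i is i'.+1 then a i' else 0).

Lemma sum_by_parts a b N :
  \sum_(i < N) a i * (b i - b i.+1) =
  \sum_(i < N.+1) backward_diff a i * b i - a N * b N.
Proof.
elim: N => [|N IH]; first by rewrite big_ord0 big_ord1 /backward_diff subr0 subrr.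
by rewrite big_ord_recr /= IH [in RHS]big_ord_recr /= {3}/backward_diff; ring.
Qed.

Lemma sum_sqr_backward_diff a N :
  \sum_(i < N.+1) backward_diff a i ^+ 2 =
  2 * (\sum_(i < N) a i ^+ 2) + a N ^+ 2 - 2 * \sum_(i < N) a i * a i.+1.
Proof.
elim: N => [|N IH]; first by rewrite big_ord1 !big_ord0 /backward_diff subr0; ring.
rewrite big_ord_recr /= IH ![\sum_(i < N.+1) _]big_ord_recr /= /backward_diff.
ring.
Qed.

Context (m : nat) (m_ge2 : (2 <= m)%N).
Let theta : R := pi / m%:R.
Let S (k : nat) : R := sin (k%:R * theta).

Let m_gt0 : 0 < m%:R :> R.
Proof. by rewrite ltr0n (leq_trans _ m_ge2). Qed.

Let S_gt0 k : (0 < k < m)%N -> 0 < S k.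
Proof.
move=> /andP[k0 km]; apply: sin_gt0_pi; rewrite /theta.
apply/andP; split; first by rewrite mulr_gt0 ?ltr0n // divr_gt0 // pi_gt0.
by rewrite mulrCA gtr_pMr ?pi_gt0 // ltr_pdivrMr // mul1r ltr_nat.
Qed.

Let S_rec k : S k + S k.+2 = 2 * cos theta * S k.+1.
Proof.
rewrite /S.
have -> : k%:R * theta = k.+1%:R * theta - theta by rewrite -natr1; ring.
have -> : k.+2%:R * theta = k.+1%:R * theta + theta by rewrite -(natr1 k.+1); ring.
rewrite !sinD cosN sinN; ring.
Qed.

(* AM-GM with the weights [S i.+2 / S i.+1]: by [S_rec], the two weights that
   fall on each [a i ^+ 2] add up to [2 * cos theta]. *)
Let cross_terms_aux a s k : s ^+ 2 = 1 -> (k.+1 < m)%N ->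
  2 * s * (\sum_(i < k) a i * a i.+1) <=
  2 * cos theta * (\sum_(i < k) a i ^+ 2) + S k / S k.+1 * a k ^+ 2.
Proof.
move=> s1; elim: k => [|k IH] km.
  by rewrite !big_ord0 /S mul0r sin0 !mul0r !mulr0 addr0.
have {IH} := IH (ltnW km).
rewrite ![\sum_(i < k.+1) _]big_ord_recr /=.
have p1 : 0 < S k.+1 by apply: S_gt0; rewrite /= ltnW.
have p2 : 0 < S k.+2 by apply: S_gt0.
have -> : S k = 2 * cos theta * S k.+1 - S k.+2 by rewrite -S_rec addrK.
have -> : (2 * cos theta * S k.+1 - S k.+2) / S k.+1 =
          2 * cos theta - S k.+2 / S k.+1 by field; rewrite gt_eqF.
set q := S k.+2 / S k.+1.
have -> : S k.+1 / S k.+2 = q^-1 by rewrite invf_div.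
have q0 : 0 < q by rewrite divr_gt0.
have : 0 <= q^-1 * (q * a k - s * a k.+1) ^+ 2.
  by rewrite mulr_ge0 ?sqr_ge0 // invr_ge0 ltW.
have -> : q^-1 * (q * a k - s * a k.+1) ^+ 2 =
  q * a k ^+ 2 - 2 * s * (a k * a k.+1) + s ^+ 2 * (q^-1 * a k.+1 ^+ 2).
  by field; rewrite gt_eqF.
rewrite s1 => H1 H2; lra.
Qed.

(** At the last index the weights close up: [S m = sin pi = 0], so the recurrence [S_rec] turns the
    remaining weight into exactly [2 * cos theta]. *)
Lemma cross_terms_le a s : s ^+ 2 = 1 -> a m.-1 = 0 ->
  2 * s * (\sum_(i < m.-1) a i * a i.+1) <=
  2 * cos theta * (\sum_(i < m.-1) a i ^+ 2).
Proof.
move=> s1; have [k mE] : exists k, m = k.+2.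
  by case: (m) (m_ge2) => [//|[//|k]] _; exists k.
have -> : m.-1 = k.+1 by rewrite mE.
move=> ak0; rewrite !big_ord_recr /= ak0 mulr0 addr0.
have km : (k.+1 < m)%N by rewrite mE.
apply: (le_trans (cross_terms_aux a s1 km)).
have p1 : 0 < S k.+1 by apply: S_gt0; rewrite mE ltnSn.
have : S k + S k.+2 = 2 * cos theta * S k.+1 := S_rec k.
have -> : S k.+2 = 0.
  rewrite -mE /S /theta mulrCA divff ?mulr1 ?sinpi //.
  by rewrite gt_eqF.
rewrite addr0 => ->.
by rewrite mulfK ?gt_eqF // mulrDr.
Qed.

(** These are the extreme eigenvalues of the tridiagonal matrix [A A^T] with diagonal 2 and
    off-diagonal -1. The sign [s = 1] in [cross_terms_le] gives the lower bound and [s = -1] the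
    upper one. *)
Lemma sum_sqr_backward_diff_bounds a : a m.-1 = 0 ->
  (2 - 2 * cos theta) * (\sum_(i < m.-1) a i ^+ 2) <=
    \sum_(i < m) backward_diff a i ^+ 2 /\
  \sum_(i < m) backward_diff a i ^+ 2 <=
    (2 + 2 * cos theta) * (\sum_(i < m.-1) a i ^+ 2).
Proof.
move=> a0.
have := sum_sqr_backward_diff a m.-1.
rewrite prednK ?(leq_trans _ m_ge2) // a0 => ->.
have := @cross_terms_le a 1 (expr1n _ _) a0.
have := @cross_terms_le a (-1) (sqrr_sign _ 1) a0.
by move=> H1 H2; split; rewrite expr0n /=; lra.
Qed.

End BackwardDifference.

Section Adjoint.
Context {R : realType} {m n : nat}.
Implicit Types (d : 'M[R]_(m.-1, n)) (y : 'M[R]_(m, n)).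

(** Extension by zero to all of [nat] supplies the boundary value at index [k], which removes the
    right boundary term in summation by parts, and avoids ordinal arithmetic. *)
Definition column_ext (k : nat) (d : 'M[R]_(k, n)) (j : 'I_n) (i : nat) : R :=
  if insub i is Some i' then d i' j else 0.

Lemma column_ext_ord (k : nat) (d : 'M[R]_(k, n)) j (i : 'I_k) :
  column_ext d j i = d i j.
Proof. by rewrite /column_ext valK. Qed.

Lemma column_ext_out (k : nat) (d : 'M[R]_(k, n)) j : column_ext d j k = 0.
Proof. by rewrite /column_ext insubF // ltnn. Qed.

Definition diff_adj d : 'M[R]_(m, n) :=
  \matrix_(i, j) backward_diff (column_ext d j) i.

Lemma diff_opE y i j : diff_op y i j = y (ord_here i) j - y (ord_next i) j.
Proof. by rewrite !mxE. Qed.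

Lemma diff_opD y z : diff_op (y + z) = diff_op y + diff_op z.
Proof. by apply/matrixP => i j; rewrite [RHS]mxE !diff_opE !mxE; ring. Qed.

Lemma diff_adjP d y : (0 < m)%N -> dotp d (diff_op y) = dotp (diff_adj d) y.
Proof.
move=> m_gt0; rewrite /dotp exchange_big [RHS]exchange_big; apply: eq_bigr => j _ /=.
transitivity (\sum_(i < m.-1) column_ext d j i *
   (column_ext y j i - column_ext y j i.+1)).
  apply: eq_bigr => i _; rewrite diff_opE column_ext_ord.
  by rewrite -[in LHS](column_ext_ord y) -[in LHS](column_ext_ord y).
rewrite sum_by_parts column_ext_out mul0r subr0 prednK //.
by apply: eq_bigr => i _; rewrite column_ext_ord !mxE.
Qed.

Lemma diff_adj_bounds d : (2 <= m)%N ->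
  (2 - 2 * cos (pi / m%:R)) * dotp d d <= dotp (diff_adj d) (diff_adj d) /\
  dotp (diff_adj d) (diff_adj d) <= (2 + 2 * cos (pi / m%:R)) * dotp d d.
Proof.
move=> m_ge2.
have E1 : dotp d d = \sum_(j < n) \sum_(i < m.-1) column_ext d j i ^+ 2.
  rewrite /dotp exchange_big; apply: eq_bigr => j _; apply: eq_bigr => i _.
  by rewrite column_ext_ord expr2.
have E2 : dotp (diff_adj d) (diff_adj d) =
    \sum_(j < n) \sum_(i < m) backward_diff (column_ext d j) i ^+ 2.
  rewrite /dotp exchange_big; apply: eq_bigr => j _; apply: eq_bigr => i _.
  by rewrite !mxE expr2.
have B j := sum_sqr_backward_diff_bounds m_ge2 (column_ext_out d j).
by rewrite E1 E2 !mulr_sumr; split; apply: ler_sum => j _; case: (B j).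
Qed.

Lemma diff_op_bound (eps : 'I_m -> R) (r : 'M[R]_(m, n)) :
  (forall i, enorm (row i r) <= eps i) ->
  dotp (diff_op r) (diff_op r) <= total_error eps ^+ 2.
Proof.
move=> re; rewrite sqr_sqrtr; last first.
  by apply: sumr_ge0 => i _; rewrite sqr_ge0.
rewrite dotp_rows; apply: ler_sum => i _.
by rewrite rowK; apply: dotpB_le.
Qed.

End Adjoint.

(** * Strongly convex and smooth functions *)

Section ConvexSmooth.
Context {R : realType} {n : nat}.
Implicit Types (phi : 'rV[R]_n -> R) (x y z v : 'rV[R]_n).

(** The quadratic term comes from the identity [t |x|^2 + (1 - t) |y|^2 - |t x + (1 - t) y|^2 = t (1
    - t) |x - y|^2]. *)
Lemma strongly_convex_le phi sigma x y (t : R) : strongly_convex sigma phi ->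
  0 <= t -> t <= 1 ->
  phi (t *: x + (1 - t) *: y) <=
  t * phi x + (1 - t) * phi y - sigma / 2 * (t * (1 - t)) * dotp (x - y) (x - y).
Proof.
move=> cvx t0 t1.
(* [convex_function] takes its weight as an element of the interval type, so the bounds on [t] are
   packaged first. *)
have t01 : Itv.spec (@Itv.num_sem R) (Itv.Real `[0%Z, 1%Z]) t.
  by apply/and3P; split; [exact: num_real|rewrite bnd_simp|rewrite bnd_simp].
have : phi (t *: x + (1 - t) *: y)
    - sigma / 2 * enorm (t *: x + (1 - t) *: y) ^+ 2 <=
    t * (phi x - sigma / 2 * enorm x ^+ 2)
    + (1 - t) * (phi y - sigma / 2 * enorm y ^+ 2).
  exact: cvx (Itv.mk t01) x y (in_setT _) (in_setT _).
by rewrite !sqr_enorm !dotpE (dotpC y x); lra.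
Qed.

Lemma derive_gradient phi x v : differentiable phi x ->
  'D_v phi x = dotp (gradient phi x) v.
Proof.
move=> dphi; rewrite deriveE // dotp_rowE.
rewrite {1}[v]row_sum_delta linear_sum; apply: eq_bigr => j _.
by rewrite linearZ mxE deriveE // mulrC.
Qed.

Lemma is_derive_line phi y v (t : R) : (forall x, differentiable phi x) ->
  is_derive t (1 : R) (fun s : R => phi (y + s *: v))
    (dotp (gradient phi (y + t *: v)) v).
Proof.
move=> dphi.
have dv : derivable phi (y + t *: v) v by apply: diff_derivable.
have E : (fun h : R => h^-1 *: ((fun s : R => phi (y + s *: v)) (h *: (1 : R) + t)
              - phi (y + t *: v))) =
         (fun h : R => h^-1 *: (phi (h *: v + (y + t *: v)) - phi (y + t *: v))).
  apply/funext => h; congr (_ *: (phi _ - _)).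
  by rewrite scalerDl scaler1 addrCA.
split; first by move: dv; rewrite /derivable /= E.
rewrite -derive_gradient // /derive.
by congr (lim _); rewrite -E.
Qed.

Lemma descent_lemma phi L y z : (forall x, differentiable phi x) ->
  lipschitz_gradient L phi ->
  phi z <= phi y + dotp (gradient phi y) (z - y) + L / 2 * dotp (z - y) (z - y).
Proof.
move=> dphi lphi; set v := z - y.
(* [psi] is [phi] along the segment minus the claimed upper bound, up to the constant [phi y].
   Cauchy-Schwarz and the Lipschitz gradient make its derivative nonpositive on [[0, 1]], and the
   mean value theorem gives [psi 1 <= psi 0]. *)
pose psi := fun t : R => phi (y + t *: v) - (t * dotp (gradient phi y) v
   + L / 2 * t ^+ 2 * dotp v v).
pose dpsi := fun t : R => dotp (gradient phi (y + t *: v)) v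
   - (dotp (gradient phi y) v + L * t * dotp v v).
have Dpsi (t : R) : is_derive t (1 : R) psi (dpsi t).
  have H := is_derive_line y v t dphi.
  apply: is_derive_eq.
  rewrite /dpsi; congr (_ - _); rewrite /GRing.scale /=.
  by field.
have [t] : exists2 t, t \in `[0, 1]%R & psi 1 - psi 0 = dpsi t * (1 - 0).
  apply: (@MVT_segment _ psi) => //.
  by apply: derivable_within_continuous => x _.
rewrite in_itv /= => /andP[t0 t1]; rewrite subr0 mulr1 => E.
have : dpsi t <= 0.
  rewrite /dpsi opprD addrA -dotpNl -dotpDl subr_le0.
  apply: le_trans (dotp_le_enorm _ _) _.
  have := lphi (y + t *: v) y; rewrite [y + _ - y]addrC addKr.
  have -> : enorm (t *: v) = t * enorm v.
    by rewrite /enorm dotpZl dotpZr mulrA -expr2 sqrtrM ?sqr_ge0 // sqrtr_sqr ger0_norm.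
  rewrite -sqr_enorm => H.
  by have := ler_wpM2r (enorm_ge0 v) H; lra.
rewrite -E /psi !scale1r scale0r addr0 /v [y + _]addrC subrK.
lra.
Qed.

End ConvexSmooth.

(** * The Lagrangian and the dual function *)

Section Lagrangian.
Context {R : realType} {m n : nat} (m_ge2 : (2 <= m)%N).
Context (f : 'I_m -> 'rV[R]_n -> R).
Implicit Types (l d : 'M[R]_(m.-1, n)) (y z w : 'M[R]_(m, n)).

Let minimizer l y := is_argmin (power_set [set: 'rV[R]_n]) (lagrangian f l) y.

Lemma minimizer_le l y z : minimizer l y -> lagrangian f l y <= lagrangian f l z.
Proof. by case=> _; apply. Qed.

Lemma lagrangianE l y :
  lagrangian f l y = \sum_(i < m) f i (row i y) + dotp (diff_adj l) y.
Proof. by rewrite /lagrangian diff_adjP // ltnW. Qed.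

Lemma lagrangianD l d y :
  lagrangian f (l + d) y = lagrangian f l y + dotp d (diff_op y).
Proof. by rewrite /lagrangian dotpDl addrA. Qed.

Lemma lagrangian_growth (mu_ : 'I_m -> R) (mu : R) l y z :
  (forall i, strongly_convex (mu_ i) (f i)) -> (forall i, mu <= mu_ i) ->
  minimizer l y ->
  lagrangian f l y + mu / 2 * dotp (z - y) (z - y) <= lagrangian f l z.
Proof.
move=> sc mule miny; set D := dotp _ _.
(* Minimality of [y] against the point [t z + (1 - t) y], divided by [t], gives the claim up to the
   factor [1 - t]. *)
have H (t : R) : 0 < t -> t <= 1 ->
    lagrangian f l y + mu / 2 * (1 - t) * D <= lagrangian f l z.
  move=> t0 t1; rewrite -(ler_pM2l t0).
  have := minimizer_le (t *: z + (1 - t) *: y) miny.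
  suff : lagrangian f l (t *: z + (1 - t) *: y) <=
      t * lagrangian f l z + (1 - t) * lagrangian f l y
      - mu / 2 * (t * (1 - t)) * D by lra.
  rewrite !lagrangianE !dotpE.
  suff : \sum_(i < m) f i (row i (t *: z + (1 - t) *: y)) <=
    t * (\sum_(i < m) f i (row i z)) + (1 - t) * (\sum_(i < m) f i (row i y))
    - mu / 2 * (t * (1 - t)) * D by lra.
  rewrite /D dotp_rows !mulr_sumr -big_split -sumrB /=; apply: ler_sum => i _.
  have -> : row i (t *: z + (1 - t) *: y) = t *: row i z + (1 - t) *: row i y.
    by rewrite linearD !linearZ.
  have -> : row i (z - y) = row i z - row i y by rewrite linearB.
  apply: le_trans (strongly_convex_le _ _ (sc i) (ltW t0) t1) _.
  rewrite lerD2l lerN2 ler_wpM2r ?dotp_ge0 // ler_wpM2r //.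
    by rewrite mulr_ge0 ?subr_ge0 // ltW.
  by rewrite ler_pM2r.
(* The passage [t -> 0] is done by contradiction: a positive defect [G] would satisfy [G <= K * t]
   for all [t] in [(0, 1]], and [t = G / (2 * K)] yields [G <= G / 2]. *)
rewrite leNgt; apply/negP => lt_zy.
set G := lagrangian f l y + mu / 2 * D - lagrangian f l z.
set K := mu / 2 * D.
have G0 : 0 < G by rewrite subr_gt0.
have HK (t : R) : 0 < t -> t <= 1 -> G <= K * t.
  by move=> t0 t1; have := H t t0 t1; rewrite /G /K; lra.
have GK : G <= K by have := HK 1 ltr01 (lexx _); rewrite mulr1.
have K0 : 0 < K by exact: lt_le_trans GK.
have K20 : 0 < 2 * K by rewrite mulr_gt0.
have := HK (G / (2 * K)) (divr_gt0 G0 K20).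
rewrite ler_pdivrMr //.
have -> : K * (G / (2 * K)) = G / 2 by field; rewrite gt_eqF.
by lra.
Qed.

Section Smooth.
Context (L_ : 'I_m -> R) (L : R).
Context (f_diff : forall i x, differentiable (f i) x).
Context (f_lip : forall i, lipschitz_gradient (L_ i) (f i)).
Context (L_le : forall i, L_ i <= L).
Context (L_gt0 : 0 < L).

(* Testing the descent lemma at [y - L^-1 *: G], where [G] is the gradient of
   the Lagrangian at a minimizer [y], forces [G = 0]. *)
Lemma lagrangian_smooth l y z : minimizer l y ->
  lagrangian f l z <= lagrangian f l y + L / 2 * dotp (z - y) (z - y).
Proof.
move=> miny.
pose G := \matrix_(i < m) gradient (f i) (row i y) + diff_adj l.
have H w : lagrangian f l w <=
    lagrangian f l y + dotp G (w - y) + L / 2 * dotp (w - y) (w - y).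
  rewrite !lagrangianE /G dotpDl.
  have -> : dotp (diff_adj l) (w - y) = dotp (diff_adj l) w - dotp (diff_adj l) y.
    by rewrite !dotpE.
  suff : \sum_(i < m) f i (row i w) <= \sum_(i < m) f i (row i y)
    + dotp (\matrix_(i < m) gradient (f i) (row i y)) (w - y)
    + L / 2 * dotp (w - y) (w - y) by lra.
  rewrite !(dotp_rows _ (w - y)) mulr_sumr -!big_split /=.
  apply: ler_sum => i _; rewrite rowK.
  have -> : row i (w - y) = row i w - row i y by rewrite linearB.
  apply: le_trans (descent_lemma (row i y) _ (f_diff i) (f_lip i)) _.
  by rewrite lerD2l ler_wpM2r ?dotp_ge0 // ler_pM2r.
have G0 : G = 0.
  apply: dotp_eq0; apply/eqP; rewrite eq_le dotp_ge0 andbT.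
  have := le_trans (minimizer_le _ miny) (H (y - L^-1 *: G)).
  rewrite [y - _]addrC addrK dotpNr dotpNl dotpNr opprK dotpZr dotpZl dotpZr.
  have -> : L / 2 * (L^-1 * (L^-1 * dotp G G)) = L^-1 * dotp G G / 2.
    by field; rewrite gt_eqF.
  by move=> h; rewrite -(ler_pM2l (_ : 0 < L^-1)) ?invr_gt0 // mulr0; lra.
have := H z; rewrite G0.
have -> : dotp 0 (z - y) = 0 by rewrite -(scale0r 0) dotpZl mul0r.
by rewrite addr0.
Qed.

(* The Polyak-Lojasiewicz inequality for [h]; [- diff_op y] is its gradient at [l]. *)
Lemma dual_gap l l' y (mu_h := 1 / L * (2 - 2 * cos (pi / m%:R))) :
  0 < mu_h -> minimizer l y ->
  exists z, - lagrangian f l y <=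
    - lagrangian f l' z + dotp (diff_op y) (diff_op y) / (2 * mu_h).
Proof.
move=> mu_h0 miny.
have [d ->] : exists d, l' = l + d by exists (l' - l); rewrite addrC subrK.
(* The witness minimizes [<g, z> + L / 2 |z - y|^2], the part depending on [z] of the quadratic
   upper bound on the Lagrangian at [l + d]. A minimizer of the Lagrangian itself at [l'] is not
   assumed to exist. *)
pose g := diff_adj d; exists (y - L^-1 *: g).
have := lagrangian_smooth (y - L^-1 *: g) miny.
rewrite lagrangianD (diff_adjP d) 1?ltnW // [y - _ - y]addrAC subrr add0r -/g.
have -> : L / 2 * dotp (- (L^-1 *: g)) (- (L^-1 *: g)) = L^-1 * dotp g g / 2.
  by rewrite dotpNl dotpNr opprK dotpZl dotpZr; field; rewrite gt_eqF.
have -> : dotp g (y - L^-1 *: g) = dotp g y - L^-1 * dotp g g.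
  by rewrite dotpDr dotpNr dotpZr.
have -> : dotp g y = dotp d (diff_op y) by rewrite diff_adjP 1?ltnW.
have : mu_h * dotp d d <= L^-1 * dotp g g.
  rewrite /mu_h div1r -mulrA ler_pM2l ?invr_gt0 //.
  by case: (diff_adj_bounds d m_ge2).
(* Young's inequality with weight [mu_h], which absorbs the term [mu_h |d|^2] from the spectral
   lower bound. *)
have := dotp_ge0 (diff_op y - mu_h *: d).
rewrite [dotp (_ - _) _]dotpDl !dotpDr !dotpNl !dotpNr !dotpZl !dotpZr.
rewrite (dotpC (diff_op y) d).
set A := dotp (diff_op y) (diff_op y) => sq bound smooth.
have sq' : 2 * dotp d (diff_op y) <= A / mu_h + mu_h * dotp d d.
  rewrite -(ler_pM2l mu_h0) mulrDr [mu_h * (A / mu_h)]mulrC divfK ?gt_eqF //.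
  by lra.
have -> : A / (2 * mu_h) = A / mu_h / 2 by field; rewrite gt_eqF.
by lra.
Qed.

End Smooth.

Section StronglyConvex.
Context (mu_ : 'I_m -> R) (mu : R).
Context (f_strong : forall i, strongly_convex (mu_ i) (f i)).
Context (mu_le : forall i, mu <= mu_ i).
Context (mu_gt0 : 0 < mu).

(** With [g] the adjoint image of [d], completing the square in [mu / 2 |z - y|^2 + <g, z - y>]
    leaves [- |g|^2 / (2 mu)], which the upper spectral bound controls. Since [z] is arbitrary, this
    bounds [h] at [l + d]. *)
Lemma dual_descent l d y z (L_h := 1 / mu * (2 + 2 * cos (pi / m%:R))) :
  minimizer l y ->
  - lagrangian f (l + d) z <=
  - lagrangian f l y - dotp d (diff_op y) + L_h / 2 * dotp d d.
Proof.
move=> miny; have grow := lagrangian_growth z f_strong mu_le miny.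
rewrite lagrangianD !diff_adjP 1?ltnW //; set g := diff_adj d.
have bound : mu^-1 * dotp g g <= L_h * dotp d d.
  rewrite /L_h div1r -mulrA ler_pM2l ?invr_gt0 //.
  by case: (diff_adj_bounds d m_ge2).
have : 0 <= mu^-1 * dotp (mu *: (z - y) + g) (mu *: (z - y) + g).
  by rewrite mulr_ge0 ?dotp_ge0 // invr_ge0 ltW.
rewrite dotpDl !dotpDr !dotpZl !dotpZr (dotpC g (z - y)) !mulrDr.
rewrite !mulKf ?gt_eqF //.
have -> : dotp (z - y) g = dotp g z - dotp g y by rewrite dotpC dotpDr dotpNr.
by lra.
Qed.

(* As [gamma <= 1 / L_h], expanding the square turns the step into
   [h+ <= h + gamma / 2 * (|A r|^2 - |A y|^2)]. *)
Lemma inexact_dual_step l y r z gamma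
    (L_h := 1 / mu * (2 + 2 * cos (pi / m%:R))) :
  minimizer l y -> 0 < gamma -> gamma * L_h <= 1 ->
  - lagrangian f (l + gamma *: diff_op (y + r)) z <=
  - lagrangian f l y
  + gamma / 2 * (dotp (diff_op r) (diff_op r) - dotp (diff_op y) (diff_op y)).
Proof.
move=> miny g0 gL.
apply: le_trans (dual_descent _ _ miny) _; rewrite -/L_h diff_opD.
set a := diff_op y; set b := diff_op r.
have : gamma * (gamma * L_h * dotp (a + b) (a + b)) <=
       gamma * (1 * dotp (a + b) (a + b)).
  by rewrite ler_pM2l // ler_wpM2r ?dotp_ge0.
rewrite !dotpZl !dotpZr !dotpDl !dotpDr (dotpC b a).
by lra.
Qed.

End StronglyConvex.

(** Quadratic growth and quadratic smoothness are compared at a nonzero displacement from [y]; the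
    all-ones matrix is nonzero because [0 < n]. This serves to derive [mu_h <= L_h]. *)
Lemma strong_convexity_le_smoothness (mu_ L_ : 'I_m -> R) (mu L : R) l y :
  (0 < n)%N -> (forall i, strongly_convex (mu_ i) (f i)) ->
  (forall i, mu <= mu_ i) -> (forall i x, differentiable (f i) x) ->
  (forall i, lipschitz_gradient (L_ i) (f i)) -> (forall i, L_ i <= L) ->
  0 < L -> minimizer l y -> mu <= L.
Proof.
move=> n0 sc mule df lip Lle L0 miny.
have D0 : 0 < dotp (const_mx 1 : 'M[R]_(m, n)) (const_mx 1).
  rewrite /dotp; under eq_bigr do under eq_bigr do rewrite !mxE mulr1.
  rewrite !sumr_const !card_ord -mulrnA ltr0n muln_gt0 n0 /=.
  exact: leq_trans m_ge2.
have := le_trans (lagrangian_growth (y + const_mx 1) sc mule miny)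
  (lagrangian_smooth df lip Lle L0 (y + const_mx 1) miny).
rewrite [y + _]addrC addrK lerD2l ler_pM2r //; lra.
Qed.

Lemma dual_function_minimizer l y : minimizer l y ->
  dual_function [set: 'rV[R]_n] f l = (lagrangian f l y)%:E.
Proof.
move=> [Dy miny]; apply/eqP; rewrite eq_le; apply/andP; split.
  by apply: ereal_inf_lbound; exists y.
by apply: le_ereal_inf_tmp => _ [z Dz <-]; rewrite lee_fin; exact: miny.
Qed.

(** Optimality bounds the value at [l'] below by the finite value at [l], and any single Lagrangian
    value bounds it above. Finiteness thus needs no minimizer at [l']. *)
Lemma dual_function_fin l l' y : minimizer l y ->
  dual_optimal [set: 'rV[R]_n] f l' ->
  exists2 g : R, dual_function [set: 'rV[R]_n] f l' = g%:E &
    forall z, g <= lagrangian f l' z.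
Proof.
move=> miny /(_ l); rewrite (dual_function_minimizer miny).
have le_l' z : (dual_function [set: 'rV[R]_n] f l' <= (lagrangian f l' z)%:E)%E.
  by apply: ereal_inf_lbound; exists z.
case: (dual_function _ _ l') le_l' => [g| |] le_l' //.
  by move=> _; exists g => // z; rewrite -lee_fin.
by have := le_l' 0.
Qed.

End Lagrangian.

(** * Linear recursions with vanishing step sizes *)

Section Recursion.
Context {R : realType}.
Implicit Types (b g v : nat -> R) (c p l : R).

Lemma limn_esup_le (u : nat -> \bar R) v l :
  (forall k, (u k <= (v k)%:E)%E) -> v @ \oo --> l ->
  (limn_esup u <= l%:E)%E.
Proof.
move=> uv vl; apply/lee_addgt0Pr => e e0.
have ev : \forall k \near \oo, v k <= l + e.
  by apply: (cvgr_le _ vl); rewrite ltrDl.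
(* The limit superior is an infimum of suprema over neighbourhoods of infinity, so one set on which
   [v k <= l + e] is enough. *)
apply: (@le_trans _ _ (ereal_sup (u @` [set k | v k <= l + e]))).
  by apply: ereal_inf_lbound; exists [set k | v k <= l + e].
apply: ge_ereal_sup => _ [k /= vk <-].
by apply: le_trans (uv k) _; rewrite -EFinD lee_fin.
Qed.

(** Iterates [1 - g k <= expR (- g k)]. Since [b] may be negative, the maximum with 0 keeps the
    bound nonnegative, so that it can be multiplied by this inequality. *)
Lemma recursion_le_expR b g :
  (forall k, g k <= 1) -> (forall k, b k.+1 <= (1 - g k) * b k) ->
  forall k, b k <= Num.max 0 (b 0%N) * expR (- series g k).
Proof.
move=> g1 bS; elim=> [|k IH].
  by rewrite /series /= big_geq // oppr0 expR0 mulr1 le_max lexx orbT.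
have M0 : 0 <= Num.max 0 (b 0%N) * expR (- series g k).
  by rewrite mulr_ge0 ?expR_ge0 // le_max lexx.
apply: le_trans (bS k) _; apply: (@le_trans _ _ ((1 - g k) *
    (Num.max 0 (b 0%N) * expR (- series g k)))).
  by rewrite ler_wpM2l // subr_ge0.
rewrite /series /= big_nat_recr //= opprD expRD [leRHS]mulrA [leLHS]mulrC ler_wpM2l //.
exact: expR_ge1Dx.
Qed.

Lemma powR_le_linear_near p : 0 < p -> p <= 1 ->
  \forall k \near \oo, k.+1%:R `^ p <= p * k.+1%:R :> R.
Proof.
move=> p0; rewrite le_eqVlt => /orP[/eqP ->|p1].
  by apply: nearW => k; rewrite powRr1 // mul1r.
near=> k.
have k0 : 0 < k.+1%:R :> R by rewrite ltr0n.
(* The threshold is [p] to the power [- 1 / (1 - p)], where [x ^ p = p * x]. *)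
have big : expR (- ln p / (1 - p)) <= k.+1%:R.
  by rewrite (@le_trans _ _ k%:R) ?ler_nat //; near: k; exact: nbhs_infty_ger.
have -> : p * k.+1%:R = expR (ln p + ln k.+1%:R) by rewrite expRD !lnK ?posrE.
rewrite /powR gt_eqF // ler_expR.
have : - ln p / (1 - p) <= ln k.+1%:R.
  by rewrite -ler_expR lnK ?posrE.
by rewrite ler_pdivrMr ?subr_gt0 //; lra.
Unshelve. all: by end_near. Qed.

(** Source of the exponent [c / p]: by [powR_le_linear_near], each increment of [ln k.+1 / p] is
    eventually at most [1 / (p * k.+1) <= 1 / k.+1 ^ p]. The constant [K] absorbs the initial
    terms. *)
Lemma ln_le_series_near p : 0 < p -> p <= 1 ->
  exists K : R, \forall k \near \oo,
    ln k.+1%:R / p <= series (fun j => (j.+1%:R `^ p)^-1) k + K.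
Proof.
move=> p0 p1; have [N _ HN] := powR_le_linear_near p0 p1.
set s := series _.
exists (ln N.+1%:R / p - s N); exists N => //.
move=> k /= /subnK <-; elim: (k - N)%N => [|j IH]; first by rewrite add0n; lra.
rewrite addSn; set i := (j + N)%N in IH *.
have i0 : 0 < i.+1%:R :> R by rewrite ltr0n.
have -> : s i.+1 = s i + (i.+1%:R `^ p)^-1 by rewrite /s /series /= big_nat_recr.
have -> : ln i.+2%:R = ln i.+1%:R + ln (1 + i.+1%:R^-1) :> R.
  rewrite -lnM ?posrE ?addr_gt0 ?invr_gt0 //; congr ln.
  by rewrite mulrDr mulr1 divff ?gt_eqF // natr1.
have lnle : ln (1 + i.+1%:R^-1) <= i.+1%:R^-1 :> R.
  by apply: le_ln1Dx; rewrite (@lt_trans _ _ 0) ?invr_gt0 // oppr_lt0.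
have step : ln (1 + i.+1%:R^-1) / p <= (i.+1%:R `^ p)^-1 :> R.
  apply: (@le_trans _ _ (i.+1%:R^-1 / p)); first by rewrite ler_pM2r ?invr_gt0.
  rewrite -invfM lef_pV2 ?posrE ?powR_gt0 ?mulr_gt0 //.
  by rewrite [leRHS]mulrC; apply: HN; rewrite /= /i leq_addl.
by rewrite mulrDl; lra.
Qed.

Lemma recursion_powR_rate b c p : 0 < p -> p <= 1 -> 0 < c -> c <= 1 ->
  (forall k, b k.+1 <= (1 - c / k.+1%:R `^ p) * b k) ->
  exists C : R, \forall k \near \oo, b k <= C / k%:R `^ (c / p).
Proof.
move=> p0 p1 c0 c1 bS; have [K HK] := ln_le_series_near p0 p1.
pose g := fun k : nat => c / k.+1%:R `^ p.
have g1 k : g k <= 1.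
  rewrite ler_pdivrMr ?powR_gt0 // mul1r (le_trans c1) //.
  by rewrite -[leLHS](powRr0 k.+1%:R); apply: ler_powR; [rewrite ler1n|exact: ltW].
set B := Num.max 0 (b 0%N).
have B0 : 0 <= B by rewrite le_max lexx.
exists (B * expR (c * K)); near=> k.
have k0 : 0 < k%:R :> R by rewrite ltr0n; near: k; exact: nbhs_infty_gt.
apply: le_trans (recursion_le_expR g1 bS k) _; rewrite -/B -mulrA.
apply: ler_wpM2l => //.
have sE : series g k = c * series (fun j => (j.+1%:R `^ p)^-1) k.
  by rewrite /series /= mulr_sumr.
rewrite /powR gt_eqF // -expRN -expRD ler_expR sE.
have : ln k%:R <= ln k.+1%:R :> R by rewrite ler_ln ?posrE // ler_nat.
have : ln k.+1%:R / p <= series (fun j => (j.+1%:R `^ p)^-1) k + K by near: k.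
move=> h1 h2.
have h3 : c * (ln k%:R / p) <= c * (ln k.+1%:R / p).
  by rewrite ler_pM2l // ler_pM2r // invr_gt0.
have := ler_wpM2l (ltW c0) h1.
have -> : c / p * ln k%:R = c * (ln k%:R / p) by ring.
by lra.
Unshelve. all: by end_near. Qed.

End Recursion.

(** * Positivity of the constants and the two convergence claims *)

Lemma cos_pi_div_bounds (R : realType) (m : nat) : (2 <= m)%N ->
  0 <= cos (pi / m%:R : R) /\ cos (pi / m%:R : R) < 1.
Proof.
move=> m_ge2.
have m0 : 0 < m%:R :> R by rewrite ltr0n ltnW.
have m2 : 2 <= m%:R :> R by rewrite ler_nat.
have t0 : 0 < pi / m%:R :> R by rewrite divr_gt0 ?pi_gt0.
have t1 : pi / m%:R <= pi / 2 :> R.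
  by rewrite ler_pM2l ?pi_gt0 // lef_pV2 ?posrE.
have pi0 := pi_gt0 R.
split; first by apply: cos_ge0_pihalf; rewrite t1 andbT; lra.
(* A positive sine excludes [cos = 1]; this strictness is what makes [mu_h] positive. *)
have s0 : 0 < sin (pi / m%:R) :> R.
  by apply: sin_gt0_pi; rewrite t0 /=; lra.
have := cos2Dsin2 (pi / m%:R : R); nra.
Qed.

Lemma cvg_expRN_series (R : realType) (gamma : nat -> R) (a B E : R) : 0 < a ->
  series gamma @ \oo --> +oo ->
  (fun k => B * expR (- series (fun j => gamma j * a) k) + E) @ \oo --> E.
Proof.
move=> a0 gammay.
have sy : series (fun j => gamma j * a) @ \oo --> +oo.
  apply/cvgryPge => A; have /cvgryPge /(_ (A / a)) := gammay.
  apply: filterS => k; rewrite ler_pdivrMr // => /le_trans; apply.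
  by rewrite /series /= mulr_suml.
have e0 : expR (- series (fun j => gamma j * a) k) @[k --> \oo] --> 0.
  exact: (cvg_comp _ _ sy (@cvgr_expR R)).
rewrite -[X in _ --> X]add0r -(mulr0 B).
by apply: cvgD; [apply: cvgMr|exact: cvg_cst].
Qed.

Theorem corollary3 (R : realType) (m n : nat)
    (m_ge2 : (2 <= m)%N) (n_ge1 : (1 <= n)%N)
    (f : 'I_m -> 'rV[R]_n -> R) (mu_ L_ : 'I_m -> R)
    (f_strict : forall i, strictly_convex (f i))
    (f_closed : forall i, closed_function (f i))
    (mu_gt0 : forall i, 0 < mu_ i)
    (f_strong : forall i, strongly_convex (mu_ i) (f i))
    (f_diff : forall i x, differentiable (f i) x)
    (L_gt0 : forall i, 0 < L_ i)
    (f_lip : forall i, lipschitz_gradient (L_ i) (f i))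
    (lambda_star : 'M[R]_(m.-1, n))
    (lambda_star_opt : dual_optimal [set: 'rV[R]_n] f lambda_star)
    (gamma : nat -> R) (r y : nat -> 'M[R]_(m, n))
    (lambda : nat -> 'M[R]_(m.-1, n)) (eps_ : 'I_m -> R)
    (alg : inexact_dual_algorithm [set: 'rV[R]_n] f gamma r y lambda)
    (r_bound : forall k i, enorm (row i (r k)) <= eps_ i) :
  let mu := min_over (ltnW m_ge2) mu_ in
  let L := max_over (ltnW m_ge2) L_ in
  let L_h := 1 / mu * (2 + 2 * cos (pi / m%:R)) in
  let mu_h := 1 / L * (2 - 2 * cos (pi / m%:R)) in
  let h := fun l : 'M[R]_(m.-1, n) =>
    (- dual_function [set: 'rV[R]_n] f l)%E in
  let eps := total_error eps_ in
  (forall k, 0 < gamma k /\ gamma k <= 1 / L_h) ->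
  series gamma @ \oo --> +oo ->
  (limn_esup (fun k => h (lambda k) - h lambda_star)
     <= (eps ^+ 2 / (2 * mu_h))%:E)%E
  /\
  (forall c p : R, 0 < p -> p <= 1 -> 0 < c -> c <= mu_h / L_h ->
    (forall k, gamma k = c / mu_h / (k.+1%:R `^ p)) ->
    exists C : R, \forall k \near \oo,
      (h (lambda k) - h lambda_star
         <= (C / (k%:R `^ (c / p)) + eps ^+ 2 / (2 * mu_h))%:E)%E).
Proof.
move=> mu L L_h mu_h h eps gammaP gammay.
have mu_le i : mu <= mu_ i by exact: bigmin_le.
have L_le i : L_ i <= L by exact: le_bigmax.
have mu0 : 0 < mu by apply: lt_bigmin => [|i _]; exact: mu_gt0.
have L0 : 0 < L by exact: lt_le_trans (L_gt0 (Ordinal (ltnW m_ge2))) (L_le _).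
have [cos_ge0 cos_lt1] := cos_pi_div_bounds R m_ge2.
have mu_h0 : 0 < mu_h.
  by rewrite mulr_gt0 ?divr_gt0 //; lra.
have L_h0 : 0 < L_h.
  by rewrite mulr_gt0 ?divr_gt0 //; lra.
have mu_h20 : 0 < 2 * mu_h by exact: mulr_gt0.
have miny k := (alg k).1.
have muL : mu <= L.
  exact: (strong_convexity_le_smoothness m_ge2 n_ge1 f_strong mu_le f_diff
    f_lip L_le L0 (miny 0%N)).
have mu_h_le : mu_h <= L_h.
  rewrite /mu_h /L_h !div1r; apply: ler_pM; [|lra| |lra].
    by rewrite invr_ge0 ltW.
  by rewrite lef_pV2 ?posrE.
have [g gE g_le] := dual_function_fin (miny 0%N) lambda_star_opt.
pose E := eps ^+ 2 / (2 * mu_h).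
pose b k := - lagrangian f (lambda k) (y k) + g - E.
have gapE k : (h (lambda k) - h lambda_star = (b k + E)%:E)%E.
  rewrite /h gE (dual_function_minimizer (miny k)) -!EFinN -EFinD opprK.
  by rewrite /b subrK.
have bS k : b k.+1 <= (1 - gamma k * mu_h) * b k.
  have [g0 gle] := gammaP k.
  have gL : gamma k * L_h <= 1 by rewrite -ler_pdivlMr.
  have := inexact_dual_step m_ge2 f_strong mu_le mu0 (r k) (y k.+1) (miny k) g0 gL.
  rewrite -(alg k).2.
  have [z] := dual_gap m_ge2 f_diff f_lip L_le L0 lambda_star mu_h0 (miny k).
  have := g_le z; have := diff_op_bound (r_bound k); rewrite -/eps -/mu_h.
  set Ay := dotp (diff_op (y k)) _; set Ar := dotp _ _ => ArE gz gap step.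
  (* [Ay] is at least [2 * mu_h * (b k + E)] and [Ar] at most [eps ^+ 2 = 2 * mu_h * E], so the
     error floor [E] cancels in [Ar - Ay] and a pure contraction of [b] remains. *)
  have gap' : 2 * mu_h * (b k + E) <= Ay.
    by rewrite mulrC -ler_pdivlMr // /b; lra.
  have epsE : eps ^+ 2 = 2 * mu_h * E.
    by rewrite /E mulrC divfK // gt_eqF.
  have decr : gamma k / 2 * (Ar - Ay) <= gamma k / 2 * (- (2 * mu_h * b k)).
    by rewrite ler_pM2l ?divr_gt0 //; lra.
  have -> : (1 - gamma k * mu_h) * b k =
    b k + gamma k / 2 * (- (2 * mu_h * b k)) by field.
  set t := gamma k / 2 * - _ in decr *.
  by rewrite /b; lra.
have g1 k : gamma k * mu_h <= 1.
  have [g0 gle] := gammaP k.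
  apply: (@le_trans _ _ (gamma k * L_h)); first by rewrite ler_pM2l.
  by rewrite -ler_pdivlMr.
split.
  rewrite -/E.
  pose v k := Num.max 0 (b 0%N) * expR (- series (fun j => gamma j * mu_h) k) + E.
  apply: (@limn_esup_le R _ v); last exact: cvg_expRN_series.
  move=> k; rewrite gapE lee_fin lerD2r.
  exact: (recursion_le_expR g1 bS k).
move=> c p p0 p1 c0 cle gammaE.
(* As [mu_h <= L_h], the bound on [c] keeps every factor [1 - c / k.+1 ^ p] nonnegative. *)
have c1 : c <= 1 by apply: le_trans cle _; rewrite ler_pdivrMr // mul1r.
have bS' k : b k.+1 <= (1 - c / k.+1%:R `^ p) * b k.
  have := bS k; rewrite gammaE.
  by have -> : c / mu_h / k.+1%:R `^ p * mu_h = c / k.+1%:R `^ p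
    by field; rewrite !gt_eqF // powR_gt0.
have [C HC] := recursion_powR_rate p0 p1 c0 c1 bS'.
by exists C; apply: filterS HC => k bC; rewrite gapE lee_fin lerD2r.
Qed.
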